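(* Let $\mathcal{T}_0$ be a finite set of trees equipped with a metric $d$. Let $T$ be a random tree with values in $\mathcal{T}_0$ and law $\nu$ such that the $d$-mean set $\mathbb{E}_d T$ has only one element (also denoted by $\mathbb{E}_d T$). Let $\{T_n : n\ge 1\}$ be an i.i.d. sequence of random trees with law $\nu$. If $y_n$ is any of the empiric mean trees of $\{T_1,\dots,T_n\}$, that is, $y_n\in\overline{T}_n$ for every $n\ge 1$, then $$\lim_{n\to\infty} d(y_n,\mathbb{E}_d T)=0\qquad\text{almost surely.}$$ In other words, almost surely, the set $\overline{T}_n$ of empiric mean trees coincides with the singleton $\{\mathbb{E}_d T\}$ for all $n$ large enough.
   Context: Trees: fix a natural number $m\geq 1$, let $A=\{1,\dots,m\}$, and let $\widetilde V$ be the set of nonempty finite sequences of elements of $A$ starting with $1$ (the vertices; the sequence $1$ is the root). For $v\in\widetilde V$ and $a\in A$, $va$ denotes the sequence obtained by appending $a$ to $v$. A tree is a function $x:\widetilde V\to\{0,1\}$ such that $x(v)\ge x(va)$ for all $v\in\widetilde V$, $a\in A$. A random tree with law $\nu$ in $\mathcal{T}_0$ is a random variable $T$ on a probability space with values in $\mathcal{T}_0$ and distribution $\nu$. The $d$-mean of $T$ is the set $\mathbb{E}_d T:=\arg\min_{y\in\mathcal{T}_0} g(y)$ of all minimizers of $g(y):=\mathbb{E}(d(T,y))=\sum_{x\in\mathcal{T}_0}\nu(x)d(x,y)$. The empiric mean of the sample $T_1,\dots,T_n$ is the (random) set $\overline{T}_n:=\arg\min_{y\in\mathcal{T}_0} g_n(y)$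 of all minimizers of $g_n(y):=\frac1n\sum_{i=1}^n d(T_i,y)$. *)

(* Defs.v *)
From HB Require Import structures.
From mathcomp Require Import all_boot all_order all_algebra.
From mathcomp Require Import finmap.
From mathcomp Require Import all_classical all_reals all_analysis.
Import Order.TTheory GRing.Theory Num.Theory numFieldNormedType.Exports.

Set Implicit Arguments.
Unset Strict Implicit.
Unset Printing Implicit Defensive.

Local Open Scope classical_set_scope.
Local Open Scope ring_scope.

(* The letter a of A = {1, ..., m} is encoded by the ordinal a - 1 of 'I_m, so
   the letter 1 is the ordinal of value 0. *)
Definition starts_at_root (m : nat) (v : seq 'I_m) : bool :=
  if v is a :: _ then val a == 0%N else false.

Record vertex (m : nat) : Type := Vertex {
  vertex_seq :> seq 'I_m ;
  vertexP : starts_at_root vertex_seq }.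

HB.instance Definition _ (m : nat) := [isSub for @vertex_seq m].
HB.instance Definition _ (m : nat) := [Countable of vertex m by <:].

Lemma child_subproof (m : nat) (v : vertex m) (a : 'I_m) :
  starts_at_root (rcons v a).
Proof. by case: v => -[]. Qed.

Definition child (m : nat) (v : vertex m) (a : 'I_m) : vertex m :=
  Vertex (child_subproof v a).

(* Booleans are compared through their coercion to {0, 1} in nat. *)
Record tree (m : nat) : Type := Tree {
  tree_fun :> vertex m -> bool ;
  treeP : forall (v : vertex m) (a : 'I_m),
    (tree_fun (child v a) <= tree_fun v)%N }.

HB.instance Definition _ (m : nat) := gen_eqMixin (tree m).
HB.instance Definition _ (m : nat) := gen_choiceMixin (tree m).
HB.instance Definition _ (m : nat) :=
  isPointed.Build (tree m) (@Tree m (fun=> false) (fun _ _ => leqnn _)).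

(* The trace on the trees of the product sigma-algebra of {0, 1}^V: on a finite
   set of trees it induces the discrete sigma-algebra. *)
Definition tree_cylinders (m : nat) : set (set (tree m)) :=
  [set [set x : tree m | x v] | v in [set: vertex m]].

HB.instance Definition _ (m : nat) :=
  @isMeasurable.Build default_measure_display (tree m)
    <<s @tree_cylinders m >> (@sigma_algebra0 _ setT _)
    (@sigma_algebraC _ _) (@sigma_algebra_bigcup _ setT _).

Record metric_on (R : realType) (X : Type) (S : set X) (d : X -> X -> R) :
    Prop := MetricOn {
  metric_on_ge0 : forall x y, S x -> S y -> 0 <= d x y ;
  metric_on_eq0 : forall x y, S x -> S y -> (d x y = 0 <-> x = y) ;
  metric_on_sym : forall x y, S x -> S y -> d x y = d y x ;
  metric_on_triangle : forall x y z, S x -> S y -> S z ->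
    d x z <= d x y + d y z }.

Definition argmin (disp : Order.disp_t) (U : porderType disp) (X : Type)
    (S : set X) (f : X -> U) : set X :=
  [set y | S y /\ forall z, S z -> (f y <= f z)%O].

Definition has_law (d d' : measure_display) (Omega : measurableType d)
    (X : measurableType d') (R : realType) (P : probability Omega R)
    (T : {RV P >-> X}) (nu : probability X R) : Prop :=
  forall A : set X, measurable A -> distribution P T A = nu A.

Definition mutually_independent (d d' : measure_display)
    (Omega : measurableType d) (X : measurableType d') (R : realType)
    (P : probability Omega R) (I : set nat) (T : nat -> {RV P >-> X}) : Prop :=
  forall (J : {fset nat}) (B : nat -> set X),
    [set` J] `<=` I -> (forall i, i \in J -> measurable (B i)) ->
    P (\bigcap_(i in [set` J]) (T i @^-1` B i)) =
    (\prod_(i <- J) P (T i @^-1` B i))%E.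

Definition iid_with_law (d d' : measure_display) (Omega : measurableType d)
    (X : measurableType d') (R : realType) (P : probability Omega R)
    (I : set nat) (T : nat -> {RV P >-> X}) (nu : probability X R) : Prop :=
  mutually_independent I T /\ forall i, I i -> has_law (T i) nu.

Definition d_mean (m : nat) (R : realType) (d : measure_display)
    (Omega : measurableType d) (P : probability Omega R)
    (T0 : set (tree m)) (dist : tree m -> tree m -> R)
    (T : {RV P >-> tree m}) : set (tree m) :=
  argmin T0 (fun y => 'E_P[fun w => dist (T w) y]%E).

Definition empiric_mean (m : nat) (R : realType) (T0 : set (tree m))
    (dist : tree m -> tree m -> R) (t : nat -> tree m) (n : nat) :
    set (tree m) :=
  argmin T0 (fun y => n%:R^-1 * \sum_(1 <= i < n.+1) dist (t i) y).

(* Main.v *)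
Require Import Defs.
From HB Require Import structures.
From mathcomp Require Import all_boot all_order all_algebra.
From mathcomp Require Import finmap ring lra.
From mathcomp Require Import all_classical all_reals all_analysis.
Import Order.TTheory GRing.Theory Num.Theory numFieldNormedType.Exports.
Local Open Scope classical_set_scope.
Local Open Scope ring_scope.

(** A tree z of T0 other than ET beats or ties ET in the sample of size n
    exactly when the sum over k <= n of D_k := dist (T_k, ET) - dist (T_k, z)
    is nonnegative. The variables D_k are i.i.d., and their common mean
    E dist (T, ET) - E dist (T, z) is negative because ET is the only minimizer
    of the expected distance. As T0 is finite, it is enough to see that almost
    surely a random walk with finitely many step values and negative drift is
    eventually negative ([iid_negative_drift]): ET is then eventually the strict
    minimizer of the empirical distance, so the set of empirical means is {ET}
    and any selection y_n is eventually equal to ET.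

    For the random walk, a Chernoff bound is quicker than the strong law of
    large numbers. Some exponential moment r = E exp (t D), t > 0, is less
    than 1, since its derivative at t = 0 is the drift
    ([negative_drift_exp_moment]). The walk being nonnegative at time n is a
    finite union of sample paths, each of probability a product by independence
    ([iid_prod_law]); weighting each path by exp (t D_1 + ... + t D_n) >= 1 and
    distributing the product bounds the probability by r ^ n ([iid_chernoff]).
    These bounds are summable, and Borel-Cantelli concludes. *)

Set Implicit Arguments.
Unset Strict Implicit.

(** * Exponential moments of a variable with negative mean *)

(** The bound is the inverse of 1 - u <= exp (- u), followed by
    1 <= (1 - u) (1 + u + 2 u^2), which holds when u <= 1 / 2. *)
Lemma expR_le_quadratic (R : realType) (u : R) :
  u <= 2^-1 -> expR u <= 1 + u + 2 * u ^+ 2.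
Proof.
move=> u2; have u1 : 0 < 1 - u by lra.
have : expR u <= (1 - u)^-1.
  rewrite -[u in expR u]opprK expRN lef_pV2 ?posrE ?expR_gt0//.
  exact: expR_ge1Dx.
move=> /le_trans; apply.
rewrite -div1r ler_pdivrMr//.
have : 0 <= u ^+ 2 * (1 - 2 * u) by rewrite mulr_ge0 ?sqr_ge0//; lra.
rewrite !expr2; nra.
Qed.

(** By the quadratic bound, the exponential moment at t is at most
    1 + t mu + 2 t^2 Q, where mu < 0 is the mean of D and Q its second moment;
    for small t the linear term wins. *)
Lemma negative_drift_exp_moment (R : realType) (I : finType) (p D : I -> R) :
  (forall i, 0 <= p i) -> \sum_i p i <= 1 -> \sum_i p i * D i < 0 ->
  exists2 t, 0 < t & \sum_i p i * expR (t * D i) < 1.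
Proof.
move=> p0 p1 pD.
set mu := \sum_i p i * D i in pD.
pose M := \sum_i `|D i|; pose Q := \sum_i p i * D i ^+ 2.
have M0 : 0 <= M by apply: sumr_ge0.
have Q0 : 0 <= Q by apply: sumr_ge0 => i _; rewrite mulr_ge0 ?sqr_ge0.
have DM i : D i <= M.
  rewrite (le_trans (ler_norm _))// /M (bigD1 i)//= lerDl.
  exact: sumr_ge0.
(* t <= a makes the quadratic bound applicable, t <= b gives mu + 2 t Q < 0. *)
pose a := (2 * (M + 1))^-1; pose b := - mu / (4 * (Q + 1)).
have a0 : 0 < a by rewrite invr_gt0; lra.
have b0 : 0 < b by rewrite divr_gt0; lra.
pose t := Num.min a b.
have t0 : 0 < t by rewrite lt_min a0.
have tM : t * M <= 2^-1.
  have : t <= a by rewrite ge_min lexx.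
  rewrite /a invfM => ta; apply: (@le_trans _ _ (2^-1 * (M + 1)^-1 * M)).
    exact: ler_wpM2r.
  rewrite -mulrA ler_piMr// mulrC ler_pdivrMr; lra.
have tQ : t * Q < - mu / 2.
  have tb : t * (4 * (Q + 1)) <= - mu.
    by rewrite -ler_pdivlMr; [rewrite ge_min lexx orbT|lra].
  nra.
exists t => //.
apply: (@le_lt_trans _ _ (\sum_i (p i + t * (p i * D i) +
    2 * t ^+ 2 * (p i * D i ^+ 2)))).
  apply: ler_sum => i _.
  have tD : t * D i <= 2^-1 by rewrite (le_trans _ tM)// ler_pM2l.
  have := ler_wpM2l (p0 i) (expR_le_quadratic tD).
  by move=> /le_trans; apply; rewrite le_eqVlt; apply/orP; left; apply/eqP; ring.
rewrite !big_split/= -!mulr_sumr -/mu -/Q.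
nra.
Qed.

(** * Finite-valued random walks *)

Section finite_valued.
Context {d d' : measure_display} {Omega : measurableType d}
  {X : measurableType d'} {R : realType} {P : probability Omega R}.

(** The definition of independence, read on the first n variables. The indices
    of the sample start at 1, hence the shift between k : 'I_n and the variable
    of index k.+1. *)
Lemma iid_prod_law (Ts : nat -> {RV P >-> X}) (nu : probability X R)
    (n : nat) (B : 'I_n -> set X) :
  iid_with_law [set k | (1 <= k)%N] Ts nu ->
  (forall k, measurable (B k)) ->
  P [set w | forall k : 'I_n, B k (Ts k.+1 w)] = (\prod_(k < n) nu (B k))%E.
Proof.
move=> [ind law] mB.
(* The family B extended to all natural indices, as independence expects. *)
pose C i := oapp B setT (insub i.-1).
have C_succ (k : 'I_n) : C k.+1 = B k by rewrite /C /= valK.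
pose J := [fset (val k).+1 | k in 'I_n]%fset.
have JP i : i \in J -> exists k : 'I_n, i = k.+1.
  by move=> /imfsetP[k _ ->]; exists k.
have JI (k : 'I_n) : k.+1 \in J by apply/imfsetP; exists k.
have := ind J C; rewrite (_ : \bigcap_(i in _) _ =
    [set w | forall k : 'I_n, B k (Ts k.+1 w)]); last first.
  apply/seteqP; split=> w /=.
    by move=> H k; have := H k.+1 (JI k); rewrite /= C_succ.
  by move=> H i /= /JP[k ->]; rewrite /= C_succ.
move=> ->.
- rewrite big_imfset/=; last by move=> i j _ _ [] /val_inj.
  rewrite big_enum/=; apply: eq_bigr => k _.
  by rewrite C_succ -(law k.+1).
- by move=> i /JP[k ->].
- by move=> i /JP[k ->]; rewrite C_succ.
Qed.

Lemma measure_bigsetU_le (I : finType) (A : pred I) (F : I -> set Omega) :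
  (forall i, measurable (F i)) ->
  (P (\big[setU/set0]_(i | A i) F i) <= \sum_(i | A i) P (F i))%E.
Proof.
move=> mF; elim: (index_enum I) => [|i s ih].
  by rewrite !big_nil measure0.
rewrite !big_cons; case: ifP => // _.
apply: (le_trans (measureU2 _ _ _)) => //.
  exact: bigsetU_measurable.
exact: leeD2l.
Qed.

(** Chernoff's bound by counting: the event is the union of the paths f of
    values with a nonnegative sum of steps. The same decomposition shows that it
    is measurable. *)
Lemma iid_chernoff (Ts : nat -> {RV P >-> X}) (nu : probability X R)
    (I : finType) (x : I -> X) (D : X -> R) (t : R) (n : nat) :
  0 < t ->
  iid_with_law [set k | (1 <= k)%N] Ts nu ->
  (forall i, measurable [set x i]) ->
  (forall k w, (1 <= k)%N -> exists i, Ts k w = x i) ->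
  let E := [set w | 0 <= \sum_(1 <= k < n.+1) D (Ts k w)] in
  measurable E /\
  (P E <= ((\sum_i fine (nu [set x i]) * expR (t * D (x i))) ^+ n)%:E)%E.
Proof.
move=> t0 iid mx Tx E.
pose p i := fine (nu [set x i]).
pose G (f : {ffun 'I_n -> I}) :=
  [set w | forall k : 'I_n, [set x (f k)] (Ts k.+1 w)].
pose A (f : {ffun 'I_n -> I}) := 0 <= \sum_k D (x (f k)).
have EE : E = \big[setU/set0]_(f | A f) G f.
  rewrite -bigcup_seq_cond; apply/seteqP; split=> w.
    rewrite /E /= big_add1 /= big_mkord => Ew.
    have /choice[f fE] : forall k : 'I_n, exists i, Ts k.+1 w = x i.
      by move=> k; exact: Tx.
    exists [ffun k => f k]; last by move=> k /=; rewrite ffunE.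
    rewrite /= mem_index_enum /A; under eq_bigr do rewrite ffunE -fE.
    by [].
  move=> [f /= /andP[_ Af] Gf]; rewrite /E /= big_add1 /= big_mkord.
  by under eq_bigr do rewrite Gf.
have mG f : measurable (G f).
  rewrite (_ : G f = \bigcap_(k in [set: 'I_n]) (Ts k.+1 @^-1` [set x (f k)])).
    apply: fin_bigcap_measurable; first exact: finite_finset.
    move=> k _; rewrite -[X in measurable X]setTI.
    by apply: measurable_funPT.
  by apply/seteqP; split=> w /= H k; have := H k => //; apply.
split; first by rewrite EE; exact: bigsetU_measurable.
rewrite EE (le_trans (measure_bigsetU_le _ _))//.
have PG f : P (G f) = (\prod_k p (f k))%:E.
  rewrite (@iid_prod_law Ts nu n (fun k => [set x (f k)]))// -prodEFin; apply: eq_bigr => k _.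
  by rewrite /p fineK// fin_num_measure.
under eq_bigr do rewrite PG.
rewrite sumEFin lee_fin -/p.
(* Expand the n-th power as a sum over all paths, then drop the paths with a
   negative sum; on the others the exponential weight is at least 1. *)
rewrite -[in leRHS](card_ord n) -prodr_const bigA_distr_bigA/=.
rewrite [leRHS](bigID A)/= -[leLHS]addr0 lerD//; last first.
  by apply: sumr_ge0 => f _; apply: prodr_ge0 => k _;
    rewrite mulr_ge0 ?expR_ge0 ?fine_ge0.
apply: ler_sum => f Af; rewrite big_split/= ler_peMr//.
  by apply: prodr_ge0 => k _; rewrite fine_ge0.
by rewrite -expR_sum -mulr_sumr -expR0 ler_expR mulr_ge0// ltW.
Qed.

Lemma borel_cantelli_geometric (E : nat -> set Omega) (r : R) :
  0 <= r < 1 -> (forall n, measurable (E n)) ->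
  (forall n, P (E n) <= (r ^+ n)%:E)%E ->
  {ae P, forall w, \forall n \near \oo, ~ E n w}.
Proof.
move=> /andP[r0 r1] mE PE.
have mlim : measurable (lim_sup_set E).
  by apply: bigcapT_measurable => n; apply: bigcup_measurable.
have : P (lim_sup_set E) = 0.
  apply: lim_sup_set_cvg0 => //.
  have geo : series (geometric 1 r) @ \oo --> 1 / (1 - r).
    by apply: cvg_geometric_series; rewrite ger0_norm.
  apply: (@le_lt_trans _ _ (\sum_(0 <= n <oo) (r ^+ n)%:E)%E).
    by apply: lee_nneseries => n _; [move=> _; exact: measure_ge0|exact: PE].
  apply: (@le_lt_trans _ _ (1 / (1 - r))%:E); last exact: ltry.
  rewrite (_ : (\sum_(0 <= n <oo) (r ^+ n)%:E)%E = (1 / (1 - r))%:E)//.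
  apply: cvg_lim => //; apply: cvg_EFin.
    by apply: nearW => n; rewrite sumEFin.
  apply: cvg_trans geo; apply: near_eq_cvg; apply: nearW => n /=.
  by rewrite sumEFin /series/=; under eq_bigr do rewrite mul1r.
move=> lim0; apply: (@negligibleS _ _ _ _ (lim_sup_set E)).
  move=> w /= H n _; apply: contrapT => nE; apply: H.
  by exists n => // k nk Ek; apply: nE; exists k.
exact/negligibleP.
Qed.

(** The Chernoff bounds decay geometrically, so by Borel-Cantelli the walk is
    nonnegative only finitely often. *)
Lemma iid_negative_drift (Ts : nat -> {RV P >-> X}) (nu : probability X R)
    (I : finType) (x : I -> X) (D : X -> R) :
  iid_with_law [set k | (1 <= k)%N] Ts nu ->
  injective x ->
  (forall i, measurable [set x i]) ->
  (forall k w, (1 <= k)%N -> exists i, Ts k w = x i) ->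
  \sum_i fine (nu [set x i]) * D (x i) < 0 ->
  {ae P, forall w, \forall n \near \oo, \sum_(1 <= k < n.+1) D (Ts k w) < 0}.
Proof.
move=> iid injx mx Tx drift.
have p0 i : 0 <= fine (nu [set x i]) by rewrite fine_ge0.
have p1 : \sum_i fine (nu [set x i]) <= 1.
  rewrite -lee_fin -sumEFin.
  under eq_bigr do rewrite fineK ?fin_num_measure//.
  rewrite -big_enum fsbig_seq ?enum_uniq// -measure_fsbig//.
    by apply: probability_le1; apply: bigsetU_measurable.
  by move=> i j _ _ [y [/= -> /injx]].
have [t t0 r1] := negative_drift_exp_moment p0 p1 drift.
set r := (\sum_i _) in r1.
have r0 : 0 <= r by apply: sumr_ge0 => i _; rewrite mulr_ge0 ?expR_ge0.
have H n := iid_chernoff D n t0 iid mx Tx.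
have : {ae P, forall w, \forall n \near \oo,
    ~ [set w | 0 <= \sum_(1 <= k < n.+1) D (Ts k w)] w}.
  apply: (@borel_cantelli_geometric _ r); first by rewrite r0.
    by move=> n; have [] := H n.
  by move=> n; have [] := H n.
apply: filterS => w; apply: filterS => n /= /negP.
by rewrite -ltNge.
Qed.

(** Since T takes finitely many values, f (T w) is a combination of indicators
    of the events T = x i. *)
Lemma expectation_finite_valued (T : {RV P >-> X}) (I : finType) (x : I -> X)
    (f : X -> R) :
  injective x -> (forall i, measurable [set x i]) ->
  (forall w, exists i, T w = x i) ->
  ('E_P[fun w => f (T w)] =
   (\sum_i fine (distribution P T [set x i]) * f (x i))%:E)%E.
Proof.
move=> injx mx Tx.
have mT i : measurable (T @^-1` [set x i]).
  rewrite -[X in measurable X]setTI; exact: measurable_funPT.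
have fT w : (f (T w))%:E =
    (\sum_i (f (x i))%:E * (\1_(T @^-1` [set x i]) w)%:E)%E.
  have [i Ti] := Tx w; rewrite (bigD1 i)//= big1 ?adde0 => [|j ji].
    by rewrite indicE mem_set//= mule1 Ti.
  rewrite indicE memNset ?mule0//= Ti => /injx ij.
  by rewrite ij eqxx in ji.
rewrite unlock; under eq_integral do rewrite fT.
have int i : P.-integrable setT (fun w => (\1_(T @^-1` [set x i]) w)%:E).
  exact: integrable_indic.
rewrite integral_sum//; last by move=> i; exact: integrableZl.
rewrite -sumEFin; apply: eq_bigr => i _.
rewrite integralZl// integral_indic// setIT EFinM fineK; last first.
  by rewrite fin_num_measure.
by rewrite muleC.
Qed.

End finite_valued.

(** * Trees *)

Lemma tree_ext (m : nat) (x y : tree m) : tree_fun x =1 tree_fun y -> x = y.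
Proof.
case: x y => [f hf] [g hg] /= /funext fg; subst g.
by congr Tree; exact: Prop_irrelevance.
Qed.

(** A tree is determined by its values at the countably many vertices, so a
    singleton is a countable intersection of cylinders and their complements. *)
Lemma measurable_tree1 (m : nat) (x : tree m) : measurable [set x].
Proof.
have mcyl (v : vertex m) : measurable [set y : tree m | y v].
  by apply: sub_sigma_algebra; exists v.
pose C n : set (tree m) := if choice.unpickle n is Some v
  then [set y : tree m | y v = x v] else setT.
rewrite (_ : [set x] = \bigcap_n C n).
  apply: bigcapT_measurable => n; rewrite /C; case: choice.unpickle => // v.
  case: (x v); first exact: mcyl.
  rewrite (_ : [set y : tree m | y v = false] = ~` [set y : tree m | y v]).
    exact: measurableC.
  by apply/seteqP; split=> y /=; [move=> ->|move=> /negP/negbTE].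
apply/seteqP; split=> y /=.
  by move=> -> n _; rewrite /C; case: choice.unpickle.
move=> H; apply: tree_ext => v.
by have := H (choice.pickle v) I; rewrite /C choice.pickleK.
Qed.

Unset Implicit Arguments.
Set Strict Implicit.

(** * Consistency of the empirical mean *)

Theorem theorem3p1 (m : nat) (hm : (1 <= m)%N) (R : realType)
    (T0 : set (tree m)) (T0_finite : finite_set T0)
    (dist : tree m -> tree m -> R) (dist_metric : metric_on T0 dist)
    (nu : probability (tree m) R)
    (d' : measure_display) (Omega' : measurableType d')
    (P' : probability Omega' R) (T : {RV P' >-> tree m})
    (T_in : forall w, T0 (T w)) (T_law : has_law T nu)
    (ET : tree m) (ET_unique : d_mean T0 dist T = [set ET])
    (d : measure_display) (Omega : measurableType d)
    (P : probability Omega R) (Ts : nat -> {RV P >-> tree m})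
    (Ts_in : forall n w, (1 <= n)%N -> T0 (Ts n w))
    (Ts_iid : iid_with_law [set n | (1 <= n)%N] Ts nu) :
  (forall y : nat -> Omega -> tree m,
    (forall n w, (1 <= n)%N -> empiric_mean T0 dist (Ts ^~ w) n (y n w)) ->
    {ae P, forall w, dist (y n w) ET @[n --> \oo] --> (0 : R)}) /\
  {ae P, forall w, \forall n \near \oo,
    empiric_mean T0 dist (Ts ^~ w) n = [set ET]}.
Proof.
have [A T0E] := finite_fsetP.1 T0_finite.
have in_A z : T0 z -> exists i : A, z = val i.
  by rewrite T0E /= => zA; exists [` zA]%fset.
have A_in (i : A) : T0 (val i) by rewrite T0E /=; exact: valP.
have mA (i : A) : measurable [set val i] by exact: measurable_tree1.
have EdE y : ('E_P'[fun w => dist (T w) y] =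
    (\sum_(i : A) fine (nu [set val i]) * dist (val i) y)%:E)%E.
  rewrite (@expectation_finite_valued _ _ _ _ _ _ T A val (dist^~ y))//.
  - by congr (_%:E); apply: eq_bigr => i _; rewrite T_law.
  - by move=> w; exact: in_A.
have [T0ET ETmin] : d_mean T0 dist T ET by rewrite ET_unique.
have ETlt z : T0 z -> z <> ET ->
    \sum_(i : A) fine (nu [set val i]) * (dist (val i) ET - dist (val i) z) < 0.
  move=> T0z zET; under eq_bigr do rewrite mulrBr.
  rewrite big_split sumrN /= subr_lt0 -lte_fin -!EdE lt_neqAle ETmin// andbT.
  apply/eqP => eqE; apply: zET.
  suff : d_mean T0 dist T z by rewrite ET_unique.
  by split=> // u T0u /=; rewrite -eqE; exact: ETmin.
(* The case val i = ET is kept vacuous so that i ranges over a finite type. *)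
have eventually_lt : {ae P, forall w, forall i : A, val i <> ET ->
    \forall n \near \oo,
    \sum_(1 <= k < n.+1) (dist (Ts k w) ET - dist (Ts k w) (val i)) < 0}.
  apply: filter_forall => i.
  have [->|/eqP iET] := eqVneq (val i) ET; first exact: aeW.
  apply: filterS (@iid_negative_drift _ _ _ _ _ _ Ts nu A val
    (fun x => dist x ET - dist x (val i)) Ts_iid val_inj mA _ _) => //.
  - by move=> k w k1; apply: in_A; exact: Ts_in.
  - exact: ETlt.
have ae_eq : {ae P, forall w, \forall n \near \oo,
    empiric_mean T0 dist (Ts ^~ w) n = [set ET]}.
  apply: filterS eventually_lt => w Hw.
  have : \forall n \near \oo, forall i : A, val i <> ET ->
      \sum_(1 <= k < n.+1) (dist (Ts k w) ET - dist (Ts k w) (val i)) < 0.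
    apply: filter_forall => i.
    have [->|/eqP iET] := eqVneq (val i) ET; first exact: nearW.
    by apply: filterS (Hw i iET).
  move=> Hn; near=> n.
  have n0 : (0 < n)%N by near: n; exists 1%N.
  have lt z : T0 z -> z <> ET ->
      n%:R^-1 * \sum_(1 <= k < n.+1) dist (Ts k w) ET <
      n%:R^-1 * \sum_(1 <= k < n.+1) dist (Ts k w) z :> R.
    move=> /in_A[i ->] iET; rewrite ltr_pM2l ?invr_gt0 ?ltr0n//.
    by rewrite -subr_lt0 -sumrB; move: i iET; near: n.
  apply/seteqP; split=> [z [T0z zmin]|_ ->].
    apply: contrapT => zET.
    by have := zmin ET T0ET; rewrite leNgt lt.
  split=> // z T0z.
  by have [->//|/eqP zET] := eqVneq z ET; exact/ltW/lt.
split=> // y y_mean.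
apply: filterS ae_eq => w Hw.
apply: cvg_near_cst; near=> n.
have n1 : (1 <= n)%N by near: n; exists 1%N.
have := y_mean n w n1; rewrite (near Hw n)// => ->.
exact/(metric_on_eq0 dist_metric).
Unshelve. all: by end_near.
Qed.
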